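(* Let $e$ be a graphic sequence in $\mathcal{P}_{s,n}$ such that $e$ has at least one forced pair. Then there is a sequence $d\in\mathcal{P}_{s,n}$ that is split or canonically decomposable and that can be obtained from $e$ by at most three elementary transformations (i.e., $d$ lies at most three covering steps above $e$ in $\mathcal{P}_{s,n}$).
   Context: $\mathcal{P}_{s,n}$ is the set of nonincreasing lists of $n$ nonnegative integers with sum $s$, ordered by dominance: $a\succeq b$ if the sums agree and $\sum_{i=1}^j a_i\ge\sum_{i=1}^j b_i$ for all $j$. An elementary transformation changes a sequence into one that covers it in $\mathcal{P}_{s,n}$ (equivalently, increases some term by 1 and decreases a later term by 1, keeping the order nonincreasing, such that the result covers the original). A list is graphic if it is the degree sequence of a finite simple graph. Realizations of $e=(e_1,\dots,e_n)$ are labeled graphs on $[n]$ in which vertex $\ell$ has degree $e_\ell$; a forced pair is a pair $\{i,j\}$ adjacent in every realization or in no realization. A split graph is one whose vertex set partitions into an independent set and a clique; a sequence is split if it has a split realization. For a split graph $F$ with partition $A$ (independent), $B$ (clique) and a graph $H$, $(F,A,B)\circ H$ is obtained from $F+H$ by adding all edges between $B$ and $V(H)$; a graph is canonically decomposable if it equals $(F,A,B)\circ H$ for nonempty induced subgraphs $F,H$ and such a partition of $V(F)$, and a sequence is canonically decomposable if it has a canonically decomposable realization. *)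

(* Defs.v *)
From mathcomp Require Import all_boot.

Set Implicit Arguments.
Unset Strict Implicit.
Unset Printing Implicit Defensive.

(* Finite simple graphs *)

Record sgraph (T : finType) := SGraph {
  adj :> rel T;
  adj_sym : symmetric adj;
  adj_irr : irreflexive adj
}.

Definition deg (T : finType) (G : sgraph T) (x : T) : nat :=
  #|[set y | G x y]|.

Definition independent (T : finType) (G : sgraph T) (A : {set T}) : Prop :=
  {in A &, forall x y, ~~ G x y}.

Definition clique (T : finType) (G : sgraph T) (B : {set T}) : Prop :=
  {in B &, forall x y, x != y -> G x y}.

(* Either of the two parts may be empty. *)
Definition split_partition (T : finType) (G : sgraph T) (A B : {set T}) : Prop :=
  [/\ A :|: B = [set: T], A :&: B = set0, independent G A & clique G B].

Definition split_graph (T : finType) (G : sgraph T) : Prop :=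
  exists A B : {set T}, split_partition G A B.

Section Induced.
Variables (T : finType) (G : sgraph T) (U : {set T}).

Definition induced_adj : rel {x | x \in U} := fun x y => G (val x) (val y).

Fact induced_sym : symmetric induced_adj.
Proof. by move=> x y; apply: adj_sym. Qed.

Fact induced_irr : irreflexive induced_adj.
Proof. by move=> x; apply: adj_irr. Qed.

Definition induced : sgraph {x | x \in U} := SGraph induced_sym induced_irr.

End Induced.

Section Composition.
Variables (S T : finType) (F : sgraph S) (B : {set S}) (H : sgraph T).

Definition compose_adj : rel (S + T)%type := fun u v =>
  match u, v with
  | inl x, inl y => F x y
  | inr x, inr y => H x y
  | inl x, inr _ => x \in B
  | inr _, inl y => y \in B
  end.

Fact compose_sym : symmetric compose_adj.
Proof. by move=> [x|x] [y|y] //=; apply: adj_sym. Qed.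

Fact compose_irr : irreflexive compose_adj.
Proof. by move=> [x|x] /=; apply: adj_irr. Qed.

End Composition.

(* (F, A, B) o H. The edge set does not involve A, which is constrained only
   through [split_partition F A B]. *)
Definition compose (S T : finType) (F : sgraph S) (A B : {set S})
    (H : sgraph T) : sgraph (S + T)%type :=
  SGraph (compose_sym F B H) (compose_irr F B H).

Definition glue (T : finType) (U : {set T})
    (u : {x | x \in U} + {x | x \in ~: U}) : T :=
  match u with inl x => val x | inr x => val x end.

(* F and H are the subgraphs of G induced on U and on its complement; [glue]
   is the canonical bijection of their disjoint vertex sets onto that of G,
   along which G equals (F, A, B) o H. *)
Definition canonically_decomposable (T : finType) (G : sgraph T) : Prop :=
  exists U : {set T}, [/\ U != set0, ~: U != set0 &
    exists A B : {set {x | x \in U}},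
      split_partition (induced G U) A B /\
      forall u v, G (glue u) (glue v)
                  = compose (induced G U) A B (induced G (~: U)) u v].

(* Degree sequences *)

Definition realizes (n : nat) (G : sgraph 'I_n) (e : n.-tuple nat) : Prop :=
  forall i : 'I_n, deg G i = tnth e i.

Definition graphic (n : nat) (e : n.-tuple nat) : Prop :=
  exists G : sgraph 'I_n, realizes G e.

Definition forced_pair (n : nat) (e : n.-tuple nat) (i j : 'I_n) : Prop :=
  i != j /\
  ((forall G : sgraph 'I_n, realizes G e -> G i j) \/
   (forall G : sgraph 'I_n, realizes G e -> ~~ G i j)).

Definition split_seq (n : nat) (d : n.-tuple nat) : Prop :=
  exists G : sgraph 'I_n, realizes G d /\ split_graph G.

Definition canonically_decomposable_seq (n : nat) (d : n.-tuple nat) : Prop :=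
  exists G : sgraph 'I_n, realizes G d /\ canonically_decomposable G.

(* The dominance order on the nonincreasing n-tuples with sum s *)

Definition partitions (s n : nat) : pred (n.-tuple nat) :=
  fun a => sorted geq a && (sumn a == s).

Arguments partitions s n : clear implicits.

Definition dominates (n : nat) (a b : n.-tuple nat) : Prop :=
  sumn a = sumn b /\ forall j, j <= n -> sumn (take j b) <= sumn (take j a).

Definition covers (s n : nat) (a b : n.-tuple nat) : Prop :=
  [/\ a \in partitions s n, b \in partitions s n, dominates a b, a <> b &
    forall c : n.-tuple nat, c \in partitions s n ->
      dominates a c -> dominates c b -> c = a \/ c = b].

Definition elementary_transformation (s n : nat) (a b : n.-tuple nat) : Prop :=
  covers s b a.

Fixpoint obtained_in (s n k : nat) (a b : n.-tuple nat) : Prop :=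
  match k with
  | 0 => a = b
  | k'.+1 => exists c : n.-tuple nat,
      elementary_transformation s a c /\ obtained_in s k' c b
  end.

(* Main.v *)
Require Import Defs.
From mathcomp Require Import all_boot.
From mathcomp Require Import zify.

Set Implicit Arguments.
Unset Strict Implicit.
Unset Printing Implicit Defensive.

(* Write D_k for the Erdos-Gallai slack k(k-1) + sum_(i > k) min(k, e_i)
   - sum_(i <= k) e_i, indices starting at 1. If a pair is forced to be an
   edge, then so is {1, 2}, by exchanging neighbours; hence e + 1_1 + 1_2 is not
   graphic and violates an Erdos-Gallai inequality, which yields k >= 1 with
   D_k <= 1. A forced nonedge is handled dually with the pair {n-1, n}.
   Comparing with a realization, D_k counts the nonedges inside {1..k} (twice)
   and the deviations outside it from the canonical structure where a vertex
   of degree at least k sees all of {1..k} and the others see nothing else.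
   If D_k = 0 the realization is split or canonically decomposable. If D_k = 1,
   its unique deviation lets one edge be rotated so that a unit of degree
   moves from beyond k into {1..k}, which makes D_k = 0. *)

Section EdgeUpdates.
Variables (T : finType) (G : sgraph T).

Definition set_adj (a b : T) (v : bool) : rel T := fun x y =>
  if (x == a) && (y == b) || (x == b) && (y == a) then v && (a != b) else G x y.

Fact set_adj_sym a b v : symmetric (set_adj a b v).
Proof. by move=> x y; rewrite /set_adj orbC adj_sym (andbC (x == a)) (andbC (x == b)). Qed.

Fact set_adj_irr a b v : irreflexive (set_adj a b v).
Proof.
move=> x; rewrite /set_adj adj_irr; case: ifP => // /orP h.
suff -> : a == b by rewrite andbF.
by case: h => /andP [/eqP <- /eqP <-].
Qed.

Definition set_edge a b v : sgraph T := SGraph (set_adj_sym a b v) (set_adj_irr a b v).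

Definition nbr (x : T) : {set T} := [set y | G x y].

Lemma deg_sum x : deg G x = \sum_y G x y.
Proof. by rewrite /deg cardsE -sum1_card big_mkcond. Qed.

Lemma adj_neq x y : G x y -> x != y.
Proof. by apply: contraTneq => ->; rewrite adj_irr. Qed.

End EdgeUpdates.

Notation add_edge G a b := (set_edge G a b true).
Notation del_edge G a b := (set_edge G a b false).

Lemma deg_add (T : finType) (G : sgraph T) a b x : a != b -> ~~ G a b ->
  deg (add_edge G a b) x = deg G x + (x == a) + (x == b).
Proof.
move=> ab nG; rewrite !deg_sum /=.
have E (p : bool) w : nat_of_bool p = \sum_(y : T) p * (y == w).
  by rewrite -big_distrr /= (bigD1 w) //= eqxx big1 ?muln1 // => i /negbTE ->.
rewrite {1}(E (x == a) b) (E (x == b) a) -!big_split /=.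
apply: eq_bigr => y _; rewrite /set_adj ab.
have [-> | xa] := eqVneq x a; have [-> | yb] := eqVneq y b.
- by rewrite (negbTE ab) (negbTE nG).
- by rewrite (negbTE ab) /= !addn0.
- by have [-> | xb] := eqVneq x b; rewrite ?(eq_sym b) ?(negbTE ab) ?andbF /= ?muln0 !addn0.
have [-> | xb] := eqVneq x b; have [-> | ya] := eqVneq y a; rewrite ?addn0 //=.
by rewrite adj_sym (negbTE nG).
Qed.

Lemma eq_deg (T : finType) (G H : sgraph T) x : G =2 H -> deg G x = deg H x.
Proof. by move=> E; rewrite !deg_sum; apply: eq_bigr => y _; rewrite E. Qed.

Lemma deg_del (T : finType) (G : sgraph T) a b x : G a b ->
  deg G x = deg (del_edge G a b) x + (x == a) + (x == b).
Proof.
move=> Gab; rewrite -deg_add ?(adj_neq Gab) //=; last by rewrite /set_adj !eqxx.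
apply: eq_deg => u v /=; rewrite /set_adj /= /set_adj (adj_neq Gab) andbT.
by case: ifP => [/orP [/andP [/eqP -> /eqP ->]|/andP [/eqP -> /eqP ->]]|->]; rewrite // adj_sym.
Qed.

Lemma private_nbr (T : finType) (G : sgraph T) u v : deg G v < deg G u ->
  exists y, [/\ G u y, ~~ G v y & y != v].
Proof.
move=> lt; have [/existsP [y /and3P [a b c]]|] :=
  boolP [exists y, [&& G u y, ~~ G v y & y != v]]; first by exists y.
move=> /existsPn H; exfalso.
have [E|uv] := eqVneq u v; first by rewrite E ltnn in lt.
have S : nbr G u :\ v \subset nbr G v :\ u.
  apply/subsetP => y; rewrite !inE => /andP [yv Guy].
  have := H y; rewrite Guy yv andbT /= negbK => ->; rewrite andbT.
  by apply: contraTneq Guy => ->; rewrite adj_irr.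
have := subset_leq_card S; have := cardsD1 v (nbr G u); have := cardsD1 u (nbr G v).
rewrite !inE (adj_sym G v u); rewrite /deg -!/(nbr _ _) in lt; lia.
Qed.

Lemma exchange_nbr (T : finType) (G : sgraph T) u v x : deg G v <= deg G u ->
  G v x -> ~~ G u x -> x != u -> exists y, [/\ G u y, ~~ G v y, y != v & y != x].
Proof.
move=> le Gvx nGux xu.
have [/existsP [y /and4P [a b c d]]|] :=
  boolP [exists y, [&& G u y, ~~ G v y, y != v & y != x]]; first by exists y.
move=> /existsPn H; exfalso.
have uv : u != v by apply: contraNneq nGux => ->.
have S : nbr G u :\ v \subset (nbr G v :\ u) :\ x.
  apply/subsetP => y; rewrite !inE => /andP [yv Guy].
  have yx : y != x by apply: contraTneq Guy => ->.
  have := H y; rewrite Guy yv yx !andbT /= negbK => ->; rewrite andbT /=.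
  by apply: contraTneq Guy => ->; rewrite adj_irr.
have := subset_leq_card S; have := cardsD1 v (nbr G u); have := cardsD1 u (nbr G v).
have := cardsD1 x (nbr G v :\ u).
rewrite !inE xu Gvx (adj_sym G v u); rewrite /deg -!/(nbr _ _) in le; lia.
Qed.

Lemma del_adj (T : finType) (G : sgraph T) a b x y :
  del_edge G a b x y = G x y && ~~ ((x == a) && (y == b) || (x == b) && (y == a)).
Proof. by rewrite /= /set_adj; case: ifP; rewrite ?andbF ?andbT. Qed.

Lemma add_adj (T : finType) (G : sgraph T) a b x y : a != b ->
  add_edge G a b x y = G x y || ((x == a) && (y == b) || (x == b) && (y == a)).
Proof. by move=> ab; rewrite /= /set_adj ab; case: ifP; rewrite ?orbT ?orbF. Qed.

Lemma transfer_unit (T : finType) (G : sgraph T) u v : deg G v < deg G u ->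
  exists H : sgraph T, forall x, deg H x + (x == u) = deg G x + (x == v).
Proof.
move=> /private_nbr [y [Guy nGvy yv]].
exists (add_edge (del_edge G u y) v y) => x.
have n1 : ~~ del_edge G u y v y by rewrite del_adj (negbTE nGvy).
rewrite deg_add // 1?eq_sym // (deg_del x Guy); lia.
Qed.

Lemma swap_nbr (T : finType) (G : sgraph T) u v x :
  deg G v <= deg G u -> G v x -> ~~ G u x -> x != u ->
  exists H : sgraph T, [/\ forall y, deg H y = deg G y, H u x & ~~ H v x].
Proof.
move=> le Gvx nGux xu; have [y [Guy nGvy yv yx]] := exchange_nbr le Gvx nGux xu.
have uv : u != v by apply: contraNneq nGux => ->.
have vx := adj_neq Gvx; have uy := adj_neq Guy.
pose G1 := del_edge G v x; pose G2 := del_edge G1 u y; pose G3 := add_edge G2 u x.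
have a1 : G1 u y by rewrite del_adj Guy (negbTE uv) andbC (negbTE yv) andbF.
have a2 : ~~ G2 u x by rewrite !del_adj (negbTE nGux).
have a3 : ~~ G3 v y.
  by rewrite add_adj 1?eq_sym // !del_adj (negbTE nGvy) (negbTE vx) eq_sym (negbTE uv).
exists (add_edge G3 v y); split.
- move=> z; rewrite deg_add 1?(eq_sym v y) // deg_add 1?(eq_sym u x) //.
  move: (deg_del z Gvx) (deg_del z a1); rewrite -/G1 -/G2.
  by generalize (nat_of_bool (z == u)) (nat_of_bool (z == v)) (nat_of_bool (z == x))
       (nat_of_bool (z == y)); clear; lia.
- by rewrite !add_adj ?(eq_sym u) ?(eq_sym v) // !eqxx orbT.
have vy : v != y by rewrite eq_sym.
have ux : u != x by rewrite eq_sym.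
rewrite !add_adj // !del_adj !eqxx (eq_sym v u) (negbTE uv) (negbTE vx) (eq_sym x v) (negbTE vx).
by rewrite (eq_sym x y) (negbTE yx) (negbTE vy) !andbF.
Qed.

Lemma sum_deg_even (n : nat) (G : sgraph 'I_n) : ~~ odd (\sum_i deg G i).
Proof.
have -> : \sum_i deg G i = \sum_(i < n) \sum_(j < n) ((i < j) && G i j : nat)
                         + \sum_(i < n) \sum_(j < n) ((j < i) && G i j : nat).
  rewrite -big_split /=; apply: eq_bigr => i _; rewrite deg_sum -big_split /=.
  apply: eq_bigr => j _; case: (ltngtP i j) => [_|_|/ord_inj ->]; rewrite ?addn0 //.
  by rewrite adj_irr.
rewrite exchange_big /= addnC.
have -> : \sum_(j < n) \sum_(i < n) ((i < j) && G i j : nat)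
        = \sum_(i < n) \sum_(j < n) ((j < i) && G i j : nat).
  by apply: eq_bigr => i _; apply: eq_bigr => j _; rewrite adj_sym.
by rewrite addnn odd_double.
Qed.

Section Slack.
Variables (T : finType) (G : sgraph T) (B : {set T}).

Lemma sum_deg_split :
  \sum_(b in B) deg G b
    = \sum_(b in B) #|nbr G b :&: B| + \sum_(x in ~: B) #|nbr G x :&: B|.
Proof.
have E x : #|nbr G x :&: B| = \sum_(y in B) G x y.
  by rewrite -sum1_card big_mkcond [RHS]big_mkcond; apply: eq_bigr => y _;
     rewrite !inE; case: (G x y); case: (y \in B).
have -> : \sum_(x in ~: B) #|nbr G x :&: B| = \sum_(x in ~: B) \sum_(y in B) G x y.
  by apply: eq_bigr => x _; rewrite E.
rewrite exchange_big /= -big_split /=; apply: eq_bigr => b bB.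
rewrite E deg_sum (bigID (mem B)) /=; congr (_ + _).
by apply: eq_big => x; rewrite ?inE // => _; rewrite adj_sym.
Qed.

End Slack.

Lemma del_nadj (T : finType) (G : sgraph T) a b x y : ~~ G x y -> ~~ del_edge G a b x y.
Proof. by rewrite del_adj => /negbTE ->. Qed.

Lemma add_nadj (T : finType) (G : sgraph T) a b x y :
  x != a -> x != b -> ~~ G x y -> ~~ add_edge G a b x y.
Proof. by move=> /negbTE xa /negbTE xb; rewrite /= /set_adj xa xb. Qed.

Lemma ord_ltF n (i j : 'I_n) : i < j -> (i == j) = false.
Proof. by move=> ij; apply: contraTF ij => /eqP ->; rewrite ltnn. Qed.

Lemma ord_gtF n (i j : 'I_n) : j < i -> (i == j) = false.
Proof. by rewrite eq_sym => /ord_ltF. Qed.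

Lemma card_ord_lt n k : k <= n -> #|[set i : 'I_n | i < k]| = k.
Proof.
move=> kn; rewrite -sum1_card.
have -> : \sum_(i in [set i : 'I_n | i < k]) 1 = \sum_(i < n | i < k) 1.
  by apply: eq_bigl => i; rewrite inE.
by rewrite -(big_ord_widen n (fun _ => 1)) // sum1_card card_ord.
Qed.

Section ErdosGallai.
Variables (n : nat) (f : 'I_n -> nat).
Hypothesis f_mono : forall i j : 'I_n, i <= j -> f j <= f i.
Hypothesis f_even : ~~ odd (\sum_i f i).

Definition indep_after (G : sgraph 'I_n) (r : nat) :=
  forall i j : 'I_n, r < i -> r < j -> ~~ G i j.

(* The invariant of the Tripathi-Venugopalan-West proof of Erdos-Gallai, which
   raises the degree of the critical vertex r without spoiling earlier ones. *)
Definition subrealization (G : sgraph 'I_n) (r : nat) :=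
  [/\ forall i, deg G i <= f i, forall i : 'I_n, i < r -> deg G i = f i
    & indep_after G r].

Lemma indep_after_del G r a b : indep_after G r -> indep_after (del_edge G a b) r.
Proof. by move=> I i j ri rj; apply/del_nadj/I. Qed.

Lemma indep_after_add G r (a b : 'I_n) :
  b <= r -> indep_after G r -> indep_after (add_edge G a b) r.
Proof.
move=> br I i j ri rj; have := I i j ri rj; rewrite /= /set_adj.
by rewrite (ord_gtF (leq_ltn_trans br ri)) (ord_gtF (leq_ltn_trans br rj)) andbF.
Qed.

Section Step.
Variables (G : sgraph 'I_n) (r : 'I_n).
Hypothesis G_sub : subrealization G r.
Hypothesis r_deficient : deg G r < f r.

Definition improved := exists2 H, subrealization H r & deg G r < deg H r.

Lemma improved_by (H : sgraph 'I_n) :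
  indep_after H r -> deg G r < deg H r <= f r ->
  (forall z : 'I_n, z < r -> deg H z = deg G z) ->
  (forall z : 'I_n, r < z -> deg H z <= f z) -> improved.
Proof.
case: G_sub => le eq I IH /andP [lt rf] zr rz; exists H; last exact: lt.
split=> // [i|i ir]; last by rewrite zr // eq.
by case: (ltngtP i r) => [/zr ->|/rz|/ord_inj ->].
Qed.

Lemma step_add (k : 'I_n) : r < k -> ~~ G r k -> deg G k < f k -> improved.
Proof.
case: G_sub => le eq I rk nG kf.
have kr : k != r by rewrite (ord_gtF rk).
have D z : deg (add_edge G k r) z = deg G z + (z == k) + (z == r).
  by apply: deg_add; rewrite // adj_sym.
apply: (improved_by (H := add_edge G k r)).
- exact: indep_after_add.
- by rewrite D eqxx eq_sym (negbTE kr); move: r_deficient; clear; lia.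
- move=> z zr; rewrite D.
  rewrite (ord_ltF (ltn_trans zr rk)).
  rewrite (ord_ltF zr).
  by rewrite !addn0.
move=> z rz; rewrite D.
rewrite (ord_gtF rz).
by move: (le z) kf; case: eqP => [->|_]; clear; lia.
Qed.

Lemma private_low (i : 'I_n) : i < r -> exists u, [/\ G i u, ~~ G r u & u != r].
Proof.
case: G_sub => le eq I ir; apply: private_nbr; rewrite (eq _ ir).
by apply: leq_trans r_deficient _; apply/f_mono/ltnW.
Qed.

Lemma step_low (i : 'I_n) : i < r -> ~~ G r i -> improved.
Proof.
case: (G_sub) => le eq I ir nGri.
have [u [Giu nGru ur]] := private_low ir.
have iu := adj_neq Giu.
have [le2|le1] := leqP (deg G r + 2) (f r).
  pose G1 := del_edge G i u; pose G2 := add_edge G1 u r.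
  have a1 : ~~ G1 u r by apply: del_nadj; rewrite adj_sym.
  have a2 : ~~ G2 i r.
    by apply: add_nadj; rewrite ?(ord_ltF ir) //; apply: del_nadj; rewrite adj_sym.
  have D z : deg (add_edge G2 i r) z = deg G z + 2 * (z == r).
    rewrite deg_add ?(ord_ltF ir) // deg_add //; move: (deg_del z Giu); rewrite -/G1.
    by generalize (nat_of_bool (z == i)) (nat_of_bool (z == r)) (nat_of_bool (z == u)); clear; lia.
  apply: (improved_by (H := add_edge G2 i r)).
  - by do 2 apply: indep_after_add => //; apply: indep_after_del.
  - by rewrite D eqxx; move: r_deficient le2; clear; lia.
  - by move=> z /ord_ltF zr; rewrite D zr addn0.
  by by move=> z /ord_gtF zr; rewrite D zr addn0.
have [k kr kf] : exists2 k : 'I_n, k != r & deg G k < f k.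
  have [/existsP [k /andP [a b]]|] := boolP [exists k : 'I_n, (k != r) && (deg G k < f k)].
    by exists k.
  move=> /existsPn H; exfalso.
  have := f_even; have := sum_deg_even G.
  rewrite (bigD1 r) //= [in X in _ -> X](bigD1 r) //=.
  have -> : \sum_(i < n | i != r) f i = \sum_(i < n | i != r) deg G i.
    apply: eq_bigr => z zr; apply/eqP.
    by rewrite eqn_leq le andbT leqNgt; have := H z; rewrite zr.
  have -> : f r = (deg G r).+1 by move: r_deficient le1; clear; lia.
  by rewrite addSn /= negbK => /negbTE ->.
have rk : r < k.
  case: (ltngtP k r) => // [/eq E|/ord_inj E]; last by rewrite E eqxx in kr.
  by rewrite E ltnn in kf.
have [Grk|nGrk] := boolP (G r k); last exact: step_add nGrk kf.
have uk : u != k by apply: contraNneq nGru => ->.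
pose G1 := del_edge G r k; pose G2 := del_edge G1 i u; pose G3 := add_edge G2 u r.
have ik : i != k by rewrite (ord_ltF (ltn_trans ir rk)).
have a1 : G1 i u by rewrite del_adj Giu (ord_ltF ir) (negbTE ik).
have a2 : ~~ G3 i r.
  by apply: add_nadj; rewrite ?(ord_ltF ir) //; do 2 apply: del_nadj; rewrite adj_sym.
have a3 : ~~ G2 u r by do 2 apply: del_nadj; rewrite adj_sym.
have D z : deg (add_edge G3 i r) z + (z == k) = deg G z + (z == r).
  rewrite deg_add ?(ord_ltF ir) // deg_add //; move: (deg_del z Grk) (deg_del z a1).
  rewrite -/G1 -/G2.
  by generalize (nat_of_bool (z == i)) (nat_of_bool (z == r)) (nat_of_bool (z == u))
       (nat_of_bool (z == k)); clear; lia.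
apply: (improved_by (H := add_edge G3 i r)).
- by do 2 apply: indep_after_add => //; do 2 apply: indep_after_del.
- by move: (D r) r_deficient; rewrite eqxx (eq_sym r) (negbTE kr); clear; lia.
- move=> z zr; move: (D z); rewrite (ord_ltF zr).
  rewrite (ord_ltF (ltn_trans zr rk)).
  by clear; lia.
by move=> z /ord_gtF zr; move: (D z) (le z); rewrite zr; clear; lia.
Qed.

Lemma step_high (k : 'I_n) : r < k -> deg G k < minn r.+1 (f k) -> improved.
Proof.
case: (G_sub) => le eq I rk dk.
have kf : deg G k < f k by apply: leq_trans dk (geq_minr _ _).
have [Grk|nGrk] := boolP (G r k); last exact: step_add nGrk kf.
have [i ir nGki] : exists2 i : 'I_n, i <= r & ~~ G k i.
  have [/existsP [i /andP [a b]]|] := boolP [exists i : 'I_n, (i <= r) && ~~ G k i].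
    by exists i.
  move=> /existsPn H; exfalso.
  have S : [set i : 'I_n | i < r.+1] \subset nbr G k.
    by apply/subsetP => i; rewrite !inE ltnS => ir; have := H i; rewrite ir negbK.
  have := subset_leq_card S; rewrite -/(deg G k).
  rewrite card_ord_lt //.
  by move: dk; clear; lia.
have {}ir : i < r.
  by rewrite ltn_neqAle ir andbT; apply: contraNneq nGki => /ord_inj ->; rewrite adj_sym.
have [u [Giu nGru ur]] := private_low ir.
have iu := adj_neq Giu.
have ki : k != i by rewrite (ord_gtF (ltn_trans ir rk)).
pose G1 := del_edge G i u; pose G2 := add_edge G1 u r.
have a1 : ~~ G1 u r by apply: del_nadj; rewrite adj_sym.
have a2 : ~~ G2 k i.
  apply: add_nadj; rewrite ?(ord_gtF rk) //; last exact: del_nadj.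
  by apply: contraNneq nGki => ->; rewrite adj_sym.
have D z : deg (add_edge G2 k i) z = deg G z + (z == k) + (z == r).
  rewrite deg_add // deg_add //; move: (deg_del z Giu); rewrite -/G1.
  by generalize (nat_of_bool (z == i)) (nat_of_bool (z == r)) (nat_of_bool (z == u))
       (nat_of_bool (z == k)); clear; lia.
apply: (improved_by (H := add_edge G2 k i)).
- apply: indep_after_add; rewrite 1?ltnW //; apply: indep_after_add => //.
  exact: indep_after_del.
- by rewrite D eqxx eq_sym (ord_gtF rk); move: r_deficient; clear; lia.
- move=> z zr; rewrite D (ord_ltF zr).
  rewrite (ord_ltF (ltn_trans zr rk)).
  by clear; lia.
by move=> z /ord_gtF zr; rewrite D zr; move: (le z) kf; case: (z =P k) => [->|_]; clear; lia.
Qed.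

Lemma step_clique (i j : 'I_n) :
  (forall l : 'I_n, l < r -> G r l) -> i != j -> i < r -> j < r -> ~~ G i j -> improved.
Proof.
case: (G_sub) => le eq I Gr ij ir jr nGij.
have high u : ~~ G r u -> u != r -> r < u.
  move=> nG ur; case: (ltngtP u r) => // [/Gr G'|/ord_inj E]; first by rewrite G' in nG.
  by rewrite E eqxx in ur.
have [u [Giu nGru ur]] := private_low ir; have ru := high u nGru ur.
have [w [Gjw nGrw wr]] := private_low jr; have rw := high w nGrw wr.
have lne (a b : 'I_n) : a < b -> a != b by move=> ab; rewrite (ord_ltF ab).
have iu := lne _ _ (ltn_trans ir ru); have ju := lne _ _ (ltn_trans jr ru).
pose G1 := del_edge G i u; pose G2 := del_edge G1 j w; pose G3 := add_edge G2 i j.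
have a1 : G1 j w by rewrite del_adj Gjw (eq_sym j i) (negbTE ij) (negbTE ju).
have a2 : ~~ G2 i j by do 2 apply: del_nadj.
have a3 : ~~ G3 u r.
  by apply: add_nadj; rewrite 1?eq_sym //; do 2 apply: del_nadj; rewrite adj_sym.
have D z : deg (add_edge G3 u r) z + (z == w) = deg G z + (z == r).
  rewrite deg_add // deg_add //; move: (deg_del z Giu) (deg_del z a1); rewrite -/G1 -/G2.
  by generalize (nat_of_bool (z == i)) (nat_of_bool (z == r)) (nat_of_bool (z == u))
       (nat_of_bool (z == w)) (nat_of_bool (z == j)); clear; lia.
apply: (improved_by (H := add_edge G3 u r)).
- by do 2 (apply: indep_after_add; first by [|exact: ltnW]); do 2 apply: indep_after_del.
- by move: (D r) r_deficient; rewrite eqxx eq_sym (ord_gtF rw); clear; lia.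
- move=> z zr; move: (D z); rewrite (ord_ltF zr).
  rewrite (ord_ltF (ltn_trans zr rw)).
  by clear; lia.
by move=> z /ord_gtF zr; move: (D z) (le z); rewrite zr; clear; lia.
Qed.

Hypothesis f_EG : \sum_(i < n | i < r.+1) f i
  <= r.+1 * r + \sum_(i < n | r < i) minn r.+1 (f i).

Lemma subrealization_step : improved.
Proof.
case: (G_sub) => le eq I.
have [/existsP [i /andP [ir nG]]|/existsPn H1] :=
  boolP [exists i : 'I_n, (i < r) && ~~ G r i]; first exact: step_low nG.
have [/existsP [k /andP [rk dk]]|/existsPn H2] :=
  boolP [exists k : 'I_n, (r < k) && (deg G k < minn r.+1 (f k))]; first exact: step_high dk.
have Gr (l : 'I_n) : l < r -> G r l by move=> lr; have := H1 l; rewrite lr negbK.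
have [/existsP [i /existsP [j /and4P [ij ir jr nG]]]|/existsPn H3] :=
  boolP [exists i : 'I_n, exists j : 'I_n, [&& i != j, i < r, j < r & ~~ G i j]].
  exact: step_clique nG.
exfalso; pose B := [set i : 'I_n | i < r.+1].
have cl i j : i \in B -> j \in B -> i != j -> G i j.
  rewrite !inE !ltnS; case: (ltngtP i r) => // [ir _|/ord_inj -> _]; last first.
    by case: (ltngtP j r) => // [/Gr //|/ord_inj ->]; rewrite eqxx.
  case: (ltngtP j r) => // [jr _ ij|/ord_inj -> _ _]; last by rewrite adj_sym Gr.
  by have /existsPn /(_ j) := H3 i; rewrite ij ir jr negbK.
have := sum_deg_split G B.
have -> : \sum_(b in B) #|nbr G b :&: B| = r.+1 * r.
  rewrite (eq_bigr (fun _ => r : nat)) ?sum_nat_const ?card_ord_lt // => b bB.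
  have -> : nbr G b :&: B = B :\ b.
    apply/setP => y; rewrite in_setI in_setD1 in_set andbC.
    have [yB|] := boolP (y \in B); rewrite ?andbF //= andbT.
    by have [->|yb] := eqVneq y b; [rewrite adj_irr | rewrite cl // eq_sym].
  by have := cardsD1 b B; rewrite bB card_ord_lt // add1n => -[].
have -> : \sum_(x in ~: B) #|nbr G x :&: B| = \sum_(i < n | r < i) minn r.+1 (f i).
  apply: eq_big => [x|x]; rewrite !inE -leqNgt // => rx.
  have -> : nbr G x :&: B = nbr G x.
    apply/setIidPl/subsetP => y; rewrite !inE ltnS leqNgt; apply: contraL => ry; exact: I.
  apply/eqP; rewrite eqn_leq leq_min le; have := H2 x; rewrite rx /= -leqNgt => ->.
  rewrite !andbT -[X in _ <= X](card_ord_lt (ltn_ord r)).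
  apply/subset_leq_card/subsetP => y; rewrite !inE ltnS leqNgt; apply: contraL => ry; exact: I.
have -> : \sum_(b in B) deg G b = \sum_(i < n | i < r.+1) deg G i.
  by apply: eq_bigl => i; rewrite inE.
move=> E; move: f_EG; rewrite -E leqNgt => /negP; apply.
rewrite (bigD1 r) //= [X in _ < X](bigD1 r) //= -addSn; apply: leq_add => //.
by apply: leq_sum.
Qed.

End Step.

Hypothesis f_EG : forall k, 0 < k <= n -> \sum_(i < n | i < k) f i
  <= k * k.-1 + \sum_(i < n | k <= i) minn k (f i).

Lemma subrealization_saturate (r : 'I_n) G :
  subrealization G r -> exists2 H, subrealization H r & deg H r = f r.
Proof.
move: {2}(f r - deg G r).+1 (ltnSn (f r - deg G r)) => m.
elim: m G => // m IH G lm sub; have [le _ _] := sub.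
have [lt|ge] := ltnP (deg G r) (f r); last first.
  by exists G => //; apply/eqP; rewrite eqn_leq le.
have [H subH ltH] := subrealization_step sub lt (f_EG (k := r.+1) (ltn_ord r)).
by apply: (IH H) => //; move: lm lt ltH; clear; lia.
Qed.

Theorem erdos_gallai : exists G : sgraph 'I_n, forall i, deg G i = f i.
Proof.
have E0 : symmetric (fun _ _ : 'I_n => false) by [].
suff H r : r <= n -> exists G, subrealization G r.
  by have [G [_ eq _]] := H n (leqnn n); exists G => i; apply: eq.
elim: r => [_|r IH rn].
  exists (SGraph E0 (fun _ => erefl)); split=> // i.
  by rewrite deg_sum big1.
have [G sub] := IH (ltnW rn).
have [H [le eq I] Hr] := subrealization_saturate (r := Ordinal rn) sub.
exists H; split=> // [i|i j ri rj]; last by apply: I; apply: ltnW.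
rewrite ltnS leq_eqVlt => /orP [/eqP E|/eq //].
by have -> : i = Ordinal rn by apply: val_inj.
Qed.

End ErdosGallai.

Definition split_or_decomposable (T : finType) (G : sgraph T) :=
  split_graph G \/ canonically_decomposable G.

Lemma block_structure (T : finType) (G : sgraph T) (A B : {set T}) :
  A :|: B != set0 -> A :&: B = set0 -> independent G A -> clique G B ->
  (forall x y, x \notin A :|: B -> y \in A -> ~~ G x y) ->
  (forall x y, x \notin A :|: B -> y \in B -> G x y) -> split_or_decomposable G.
Proof.
move=> U0 AB iA cB nA aB; have [C0|C0] := eqVneq (~: (A :|: B)) set0.
  by left; exists A, B; split=> //; rewrite -[LHS]setCK C0 setC0.
right; exists (A :|: B); split=> //.
exists [set x | val x \in A], [set x | val x \in B]; split.
  split.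
  - by apply/setP => x; have := valP x; rewrite !inE.
  - by apply/setP => x; have := in_set0 (val x); rewrite -AB !inE => ->.
  - by move=> x y; rewrite !inE; apply: iA.
  - by move=> x y; rewrite !inE => xB yB xy; apply: cB.
have dec (x : {x | x \in A :|: B}) (y : {x | x \in ~: (A :|: B)}) :
    G (val y) (val x) = (val x \in B).
  have yC : val y \notin A :|: B by have := valP y; rewrite in_setC.
  have [xB|xB] := boolP (val x \in B); first exact: aB.
  by apply/negbTE/nA => //; have := valP x; rewrite in_setU (negbTE xB) orbF.
by move=> [x|x] [y|y] //=; rewrite inE ?dec // adj_sym dec.
Qed.

Section Slack.
Variables (T : finType) (G : sgraph T) (B : {set T}).
Let k := #|B|.
Let term_in b := k.-1 - #|nbr G b :&: B|.
Let term_out x := minn k (deg G x) - #|nbr G x :&: B|.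

Lemma nbr_in_le b : b \in B -> #|nbr G b :&: B| <= k.-1.
Proof.
move=> bB; have := cardsD1 b B; rewrite bB -/k => ->; rewrite add1n /=.
apply/subset_leq_card/subsetP => y; rewrite !inE => /andP [Gby ->].
by rewrite andbT; apply: contraTneq Gby => ->; rewrite adj_irr.
Qed.

Lemma nbr_out_le x : #|nbr G x :&: B| <= minn k (deg G x).
Proof. by rewrite leq_min !subset_leq_card ?subsetIl ?subsetIr. Qed.

Lemma slack_terms t :
  k * k.-1 + \sum_(x in ~: B) minn k (deg G x) <= \sum_(b in B) deg G b + t ->
  \sum_(b in B) term_in b + \sum_(x in ~: B) term_out x <= t.
Proof.
rewrite sum_deg_split /term_in /term_out -sum_nat_const.
rewrite sumnB; last exact: nbr_in_le.
rewrite sumnB; last by move=> x _; apply: nbr_out_le.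
have a : \sum_(b in B) #|nbr G b :&: B| <= \sum_(b in B) k.-1.
  by apply: leq_sum => b; apply: nbr_in_le.
have c : \sum_(x in ~: B) #|nbr G x :&: B| <= \sum_(x in ~: B) minn k (deg G x).
  by apply: leq_sum => x _; apply: nbr_out_le.
move: a c; clear; lia.
Qed.

Lemma term_in_gt0 b c :
  b \in B -> c \in B -> b != c -> ~~ G b c -> 0 < term_in b.
Proof.
move=> bB cB bc nG; rewrite subn_gt0; have := cardsD1 b B; rewrite bB -/k => ->.
rewrite add1n /=; apply/proper_card/properP; split.
  apply/subsetP => y; rewrite !inE => /andP [Gby ->].
  by rewrite andbT; apply: contraTneq Gby => ->; rewrite adj_irr.
by exists c; rewrite !inE ?(negbTE nG) // eq_sym bc.
Qed.

Lemma tight_structure : B != set0 -> clique G B ->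
  (forall x, x \notin B -> term_out x = 0) -> split_or_decomposable G.
Proof.
move=> B0 cB H; pose A := [set x in ~: B | deg G x < k].
have low x y : x \in A -> G x y -> y \in B.
  rewrite !inE => /andP [xB dx] Gxy; have := H x xB; rewrite /term_out.
  move=> /eqP; rewrite subn_eq0 => le; have E : nbr G x :&: B == nbr G x.
    rewrite eqEcard subsetIl /= -/(deg G x); move: le dx; clear; lia.
  by have : y \in nbr G x by [rewrite inE]; rewrite -(eqP E) inE => /andP [].
have high x y : x \notin B -> k <= deg G x -> y \in B -> G x y.
  move=> xB dx yB; have := H x xB; rewrite /term_out => /eqP; rewrite subn_eq0 => le.
  have E : nbr G x :&: B == B.
    rewrite eqEcard subsetIr /= -/k; move: le dx; clear; lia.
  by move: yB; rewrite -(eqP E) !inE => /andP [].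
apply: (block_structure (A := A) (B := B)) => //.
- by apply: contraNneq B0 => E; rewrite -subset0 -E subsetUr.
- by apply/setP => x; rewrite !inE; case: (x \in B); rewrite ?andbF.
- by move=> x y xA yA; apply/negP => /(low _ _ xA) yB; rewrite !inE yB in yA.
- move=> x y; rewrite inE negb_or => /andP [_ xB] yA.
  by apply: contraNN xB; rewrite adj_sym; apply: low.
move=> x y; rewrite !inE negb_or => /andP [+ xB]; rewrite xB /= -leqNgt => dx yB.
exact: high.
Qed.

Lemma slack0_structure : B != set0 ->
  k * k.-1 + \sum_(x in ~: B) minn k (deg G x) <= \sum_(b in B) deg G b ->
  split_or_decomposable G.
Proof.
move=> B0 H; have := @slack_terms 0; rewrite addn0 => /(_ H).
rewrite leqn0 addn_eq0 !sum_nat_eq0 => /andP [/forall_inP I /forall_inP O].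
apply: tight_structure => // [|x xB]; last by apply/eqP/O; rewrite inE.
move=> b c /[dup] bB /I /eqP tb cB bc; apply/negPn/negP => nG.
by have := term_in_gt0 bB cB bc nG; rewrite tb.
Qed.

Lemma slack1_structure : B != set0 ->
  k * k.-1 + \sum_(x in ~: B) minn k (deg G x) <= (\sum_(b in B) deg G b).+1 ->
  split_or_decomposable G \/
  exists b y H, [/\ b \in B, y \notin B, k < deg G y
    & forall z, deg (H : sgraph T) z + (z == y) = deg G z + (z == b)].
Proof.
move=> B0; rewrite -addn1 => /slack_terms le1.
have cB : clique G B.
  move=> b c bB cB bc; apply/negPn/negP => nG.
  have pb := term_in_gt0 bB cB bc nG.
  have pc : 0 < term_in c by apply: (@term_in_gt0 c b) => //; rewrite 1?eq_sym // adj_sym.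
  move: le1; rewrite (bigD1 b) //= (bigD1 c) /=; last by rewrite cB eq_sym.
  move: pb pc; clear; lia.
have [/existsP [x /andP [xB px]]|/existsPn H] :=
    boolP [exists x, (x \notin B) && (0 < term_out x)]; last first.
  left; apply: tight_structure => // x xB; apply/eqP; rewrite -leqn0 leqNgt.
  by have := H x; rewrite xB.
right.
have out0 y : y \notin B -> y != x -> term_out y = 0.
  move=> yB yx; apply/eqP; rewrite -leqn0 leqNgt; apply/negP => py.
  move: le1; rewrite [X in _ + X](bigD1 x) /=; last by rewrite inE.
  rewrite [X in _ + (_ + X)](bigD1 y) /=; last by rewrite inE yB.
  move: px py; clear; lia.
have [b bB nGxb] : exists2 b, b \in B & ~~ G x b.
  have /subsetPn [b bB] : ~~ (B \subset nbr G x).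
    apply: contraTN px => /setIidPr E; rewrite /term_out E -/k subn_gt0 -leqNgt.
    exact: geq_minl.
  by rewrite inE; exists b.
have [y yB Gxy] : exists2 y, y \notin B & G x y.
  have /subsetPn [y] : ~~ (nbr G x \subset B).
    apply: contraTN px => /setIidPl E; rewrite /term_out E -/(deg G x) subn_gt0 -leqNgt.
    exact: geq_minr.
  by rewrite inE; exists y.
have xb : x != b by apply: contraNneq xB => ->.
exists b, y, (add_edge (del_edge G x y) x b); split=> //.
  have := out0 y yB; rewrite eq_sym => /(_ (adj_neq Gxy)) /eqP; rewrite subn_eq0 => le.
  have : #|nbr G y :&: B| < deg G y.
    apply/proper_card/properP; split; first exact: subsetIl.
    by exists x; rewrite !inE ?(negbTE xB) ?andbF // adj_sym.
  move: le; clear; lia.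
move=> z; rewrite deg_add //; last by rewrite del_adj (negbTE nGxb).
move: (deg_del z Gxy).
by generalize (nat_of_bool (z == x)) (nat_of_bool (z == y)) (nat_of_bool (z == b)); clear; lia.
Qed.

End Slack.

Lemma erdos_gallai_fail n (f : 'I_n -> nat) :
  (forall i j : 'I_n, i <= j -> f j <= f i) -> ~~ odd (\sum_i f i) ->
  ~ (exists G : sgraph 'I_n, deg G =1 f) ->
  exists2 k, 0 < k <= n
    & k * k.-1 + \sum_(i < n | k <= i) minn k (f i) < \sum_(i < n | i < k) f i.
Proof.
move=> mono even nG.
have [/existsP [k /andP [k0 lt]]|/existsPn H] := boolP [exists k : 'I_n.+1, (0 < k) &&
    (k * k.-1 + \sum_(i < n | k <= i) minn k (f i) < \sum_(i < n | i < k) f i)].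
  by exists (k : nat) => //; rewrite k0 -ltnS ltn_ord.
exfalso; apply: nG; apply: erdos_gallai => // k /andP [k0 kn].
rewrite -ltnS in kn; by have := H (Ordinal kn); rewrite k0 /= -leqNgt.
Qed.

Lemma sum_indicator_le1 (I : finType) (P : pred I) a : \sum_(i | P i) (i == a) <= 1.
Proof.
rewrite big_mkcond (bigD1 a) //= big1 ?addn0; first by rewrite eqxx; case: ifP.
by move=> i /negbTE ->; case: ifP.
Qed.

Section Forced.
Variables (n : nat) (f : 'I_n -> nat).
Hypothesis f_mono : forall i j : 'I_n, i <= j -> f j <= f i.

Definition nearly_tight k :=
  k * k.-1 + \sum_(i < n | k <= i) minn k (f i) <= (\sum_(i < n | i < k) f i).+1.

Lemma nonedge_up (G : sgraph 'I_n) a b a' : deg G =1 f ->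
  ~~ G a b -> a != b -> f a' <= f a -> a' != b -> exists2 H : sgraph 'I_n, deg H =1 f & ~~ H a' b.
Proof.
move=> dG nG ab le a'b; have [G'|] := boolP (G a' b); last by exists G.
have [||H [dH _ nH]] := swap_nbr (u := a) _ G' nG; rewrite 1?eq_sym ?dG //.
by exists H => // x; rewrite dH.
Qed.

Lemma edge_down (G : sgraph 'I_n) a b a' : deg G =1 f ->
  G a b -> f a <= f a' -> a' != b -> exists2 H : sgraph 'I_n, deg H =1 f & H a' b.
Proof.
move=> dG Gab le a'b; have [|nG] := boolP (G a' b); first by exists G.
have [||H [dH H' _]] := swap_nbr (u := a') _ Gab nG; rewrite 1?eq_sym ?dG //.
by exists H => // x; rewrite dH.
Qed.

Lemma forced_edge_tight (G : sgraph 'I_n) (i j u v : 'I_n) :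
  u = 0 :> nat -> v = 1 :> nat -> i < j -> deg G =1 f ->
  (forall H : sgraph 'I_n, deg H =1 f -> H i j) ->
  exists2 k, 0 < k <= n & nearly_tight k.
Proof.
move=> u0 v1 ij dG forced.
have uv : u != v by apply/eqP => E; move: v1; rewrite -E u0.
have all01 (H : sgraph 'I_n) : deg H =1 f -> H u v.
  move=> dH; apply/negPn/negP => nH.
  have fj : f j <= f v by apply: f_mono; rewrite v1; apply: leq_ltn_trans ij.
  have ju : j != u by apply: contraTneq ij => ->; rewrite u0.
  have [||H1 d1 n1] := nonedge_up (a := v) (b := u) dH _ _ fj ju; rewrite 1?adj_sym 1?eq_sym //.
  have fi : f i <= f u by apply: f_mono; rewrite u0.
  have [|||H2 d2 n2] := nonedge_up (a := u) (b := j) d1 _ _ fi; rewrite 1?adj_sym 1?eq_sym //.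
    by rewrite (ord_gtF ij).
  by rewrite forced in n2.
pose f1 z := f z + (z == u) + (z == v).
have := @erdos_gallai_fail n f1; case.
- move=> a b ab; rewrite /f1.
  have [bu|bu] := eqVneq b u; have [bv|bv] := eqVneq b v; rewrite ?addn0.
  + by move: uv; rewrite -bu bv eqxx.
  + have -> : a = u by apply: val_inj; move: ab; rewrite bu /= u0; case: (val a).
    by rewrite eqxx bu leq_addr.
  + have := f_mono ab; move: ab; rewrite bv v1; case: (ltngtP a 1) => // [a0 _|a1 _].
      have -> : a = u by apply: val_inj; move: a0; rewrite /= u0; case: (val a).
      by rewrite eqxx; lia.
    have -> : a = v by apply: val_inj; rewrite /= v1.
    by rewrite eqxx; lia.
  by apply: leq_trans (f_mono ab) _; rewrite -addnA leq_addr.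
- rewrite /f1 !big_split /= -(eq_bigr _ (fun i _ => dG i)).
  have S a : \sum_(z < n) (z == a) = 1.
    by rewrite (bigD1 a) //= eqxx big1 // => z /negbTE ->.
  by rewrite !S !addn1 /= negbK sum_deg_even.
- case=> H dH.
  have [H' dH' Huv] : exists2 H' : sgraph 'I_n, deg H' =1 f1 & H' u v.
    have [|nH] := boolP (H u v); first by exists H.
    have [x] : exists x, x \in nbr H u.
      by apply/card_gt0P; rewrite -/(deg H u) dH /f1 eqxx addn1.
    rewrite inE => Hux.
    have xv : x != v by apply: contraNneq nH => <-.
    have xu : x != u by rewrite eq_sym (adj_neq Hux).
    have le : deg H x <= deg H v.
      rewrite !dH /f1 eqxx (negbTE xv) (negbTE xu) (eq_sym v) (negbTE uv) !addn0.
      apply: leq_trans (leq_addr _ _); apply: f_mono; rewrite v1 lt0n.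
      by apply: contraNneq xu => x0; apply/eqP/val_inj; rewrite /= x0 u0.
    have [|||H' [dH' Hvu _]] := swap_nbr (x := u) le; rewrite 1?adj_sym //.
    by exists H'; rewrite 1?adj_sym // => z; rewrite dH'.
  have : del_edge H' u v u v.
    by apply: all01 => z; have := deg_del z Huv; rewrite dH' /f1 => /addIn /addIn ->.
  by rewrite del_adj !eqxx andbF.
move=> k kn lt; exists k => //; rewrite /nearly_tight.
have a : \sum_(i < n | i < k) (i == u) <= 1 by apply: sum_indicator_le1.
have b : \sum_(i < n | i < k) (i == v) <= 1 by apply: sum_indicator_le1.
have c : \sum_(i < n | k <= i) minn k (f i)
  <= \sum_(i < n | k <= i) minn k (f i + (i == u) + (i == v)).
  by apply: leq_sum => z _; rewrite leq_min geq_minl -addnA geq_min leq_addr orbT.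
have d : \sum_(i < n | i < k) f1 i = \sum_(i < n | i < k) f i
    + \sum_(i < n | i < k) (i == u) + \sum_(i < n | i < k) (i == v).
  by rewrite -!big_split.
move: a b c lt; rewrite d /f1 /=.
set S1 := \sum_(i < n | i < k) (i == u); set S2 := \sum_(i < n | i < k) (i == v).
move: S1 S2 => S1 S2; clear; lia.
Qed.

Lemma forced_nonedge_tight (G : sgraph 'I_n) (i j u v : 'I_n) :
  u.+2 = n -> v.+1 = n -> i < j -> deg G =1 f -> 0 < f v ->
  (forall H : sgraph 'I_n, deg H =1 f -> ~~ H i j) ->
  exists2 k, 0 < k <= n & nearly_tight k.
Proof.
move=> un vn ij dG fv0 forced.
have vu : v = u.+1 :> nat by apply: succn_inj; rewrite vn un.
have u_lt_v : u < v by rewrite vu.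
have uv : u != v by rewrite (ord_ltF u_lt_v).
have max_v (z : 'I_n) : z <= v by rewrite -ltnS vn.
have fvu : f v <= f u by apply: f_mono.
have none (H : sgraph 'I_n) : deg H =1 f -> ~~ H u v.
  move=> dH; apply/negP => Huv.
  have iv : i < v by apply: leq_trans ij (max_v j).
  have fi : f u <= f i by apply: f_mono; rewrite -ltnS -vu.
  have [|H1 d1 H1iv] := edge_down dH Huv fi; first by rewrite (ord_ltF iv).
  rewrite adj_sym in H1iv.
  have [|H2 d2 H2ji] := edge_down d1 H1iv (f_mono (max_v j)); first by rewrite (ord_gtF ij).
  by have := forced H2 d2; rewrite adj_sym H2ji.
pose f2 z := f z - (z == u) - (z == v).
have f2E z : f z = f2 z + (z == u) + (z == v).
  rewrite /f2; have [->|_] := eqVneq z u; first by rewrite (negbTE uv); move: fv0 fvu; clear; lia.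
  by case: eqVneq => [->|_]; move: fv0; clear; lia.
have := @erdos_gallai_fail n f2; case.
- move=> a b ab.
  have [au|au] := eqVneq a u; last have [av|av] := eqVneq a v.
  + have [->|bu] := eqVneq b u; first by rewrite au.
    have -> : b = v.
      apply: val_inj; apply/eqP; rewrite eqn_leq max_v /= vu ltn_neqAle.
      by rewrite -au ab andbT au eq_sym.
    rewrite /f2 au !eqxx (negbTE uv) eq_sym (negbTE uv); move: fvu; clear; lia.
  + by have -> : b = a by apply: val_inj; apply/eqP; rewrite eqn_leq ab av max_v.
  have := f_mono ab; rewrite !f2E (negbTE au) (negbTE av); clear; lia.
- have := sum_deg_even G; rewrite (eq_bigr _ (fun i _ => dG i)) (eq_bigr _ (fun i _ => f2E i)).
  have S a : \sum_(z < n) (z == a) = 1.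
    by rewrite (bigD1 a) //= eqxx big1 // => z /negbTE ->.
  by rewrite !big_split /= !S !addn1 /= negbK.
- case=> H dH.
  have [H' dH' Huv] : exists2 H' : sgraph 'I_n, deg H' =1 f2 & ~~ H' u v.
    have [Huv|] := boolP (H u v); last by exists H.
    have [x] : exists2 x, x \in nbr G v & x \notin nbr H v.
      apply/subsetPn; apply: contraTN isT => /subset_leq_card.
      by rewrite -/(deg G v) -/(deg H v) dG dH (f2E v) eqxx addn1 leqNgt leq_addr.
    rewrite !inE => Gvx nHvx.
    have xu : x != u by apply: contraNneq nHvx => ->; rewrite adj_sym.
    have vx := adj_neq Gvx.
    have le : deg H u <= deg H x.
      have xv : x < v by rewrite ltn_neqAle max_v eq_sym vx.
      have : f u <= f x by apply: f_mono; rewrite -ltnS -vu.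
      rewrite !dH /f2 (negbTE xu) (ord_ltF xv); clear; lia.
    have nHxv : ~~ H x v by rewrite adj_sym.
    have [H' [dH' _ Hvu]] := swap_nbr le Huv nHxv vx.
    by exists H' => // z; rewrite dH'.
  have : ~~ add_edge H' u v u v.
    by apply: none => z; rewrite deg_add // dH' -f2E.
  by rewrite add_adj // !eqxx orbT.
move=> k kn lt; exists k => //; rewrite /nearly_tight.
have a : \sum_(i < n | k <= i) (i == u) <= 1 by apply: sum_indicator_le1.
have b : \sum_(i < n | k <= i) (i == v) <= 1 by apply: sum_indicator_le1.
have c : \sum_(i < n | k <= i) minn k (f i)
  <= \sum_(i < n | k <= i) (minn k (f2 i) + (i == u) + (i == v)).
  by apply: leq_sum => z _; rewrite (f2E z); clear; lia.
have d : \sum_(i < n | i < k) f2 i <= \sum_(i < n | i < k) f i.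
  by apply: leq_sum => z _; rewrite (f2E z) -addnA leq_addr.
have g : \sum_(i < n | k <= i) (minn k (f2 i) + (i == u) + (i == v))
    = \sum_(i < n | k <= i) minn k (f2 i)
    + \sum_(i < n | k <= i) (i == u) + \sum_(i < n | k <= i) (i == v).
  by rewrite -!big_split.
move: c; rewrite g; move: a b d lt; clear; lia.
Qed.

End Forced.

Lemma sumn_takeS (a : seq nat) j : sumn (take j.+1 a) = sumn (take j a) + nth 0 a j.
Proof.
have [ja|ja] := ltnP j (size a); first by rewrite (take_nth 0 ja) sumn_rcons.
by rewrite nth_default // !take_oversize ?addn0 //; apply: leqW.
Qed.

Lemma geq_sorted_nth (a : seq nat) i j : sorted geq a -> i <= j -> nth 0 a j <= nth 0 a i.
Proof.
move=> sa ij; have [ja|ja] := ltnP j (size a); last by rewrite nth_default.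
have tr : transitive geq by move=> x y z yx zy; apply: leq_trans zy yx.
by apply: (sorted_leq_nth tr leqnn 0 sa) => //; apply: leq_ltn_trans ja.
Qed.

Section Partitions.
Variables (s n : nat).
Implicit Types a b c : n.-tuple nat.

Lemma eq_nth_tuple a b : (forall i, nth 0 a i = nth 0 b i) -> a = b.
Proof. by move=> H; apply: eq_from_tnth => i; rewrite !(tnth_nth 0). Qed.

Lemma eq_prefix_tuple a b :
  (forall j, j <= n -> sumn (take j a) = sumn (take j b)) -> a = b.
Proof.
move=> H; apply: eq_from_tnth => i; rewrite !(tnth_nth 0).
by have := H i.+1 (ltn_ord i); rewrite !sumn_takeS H 1?ltnW // => /addnI.
Qed.

(* The subtraction truncates, so this moves a unit only if a_q > 0 or p = q. *)
Definition move_unit a p q : n.-tuple nat :=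
  [tuple nth 0 a i + (i == p :> nat) - (i == q :> nat) | i < n].

Section MoveUnit.
Variables (a : n.-tuple nat) (p q : nat).
Hypotheses (pq : p <= q) (qn : q < n).

Lemma nth_move_unit i : nth 0 (move_unit a p q) i = nth 0 a i + (i == p) - (i == q).
Proof.
have [lin|ni] := ltnP i n; last first.
  rewrite !nth_default ?size_tuple //; move: pq qn ni; clear; lia.
by rewrite -[i]/(val (Ordinal lin)) -tnth_nth tnth_mktuple.
Qed.

Hypothesis aq : 0 < nth 0 a q.

Lemma sumn_take_move_unit j :
  sumn (take j (move_unit a p q)) + (q < j) = sumn (take j a) + (p < j).
Proof.
elim: j => [|j IH]; first by rewrite !take0.
rewrite !sumn_takeS nth_move_unit; move: IH aq pq.
have [->|] := eqVneq j q; have [] := eqVneq _ p; clear; lia.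
Qed.

Lemma sumn_move_unit : sumn (move_unit a p q) = sumn a.
Proof.
have := sumn_take_move_unit n; rewrite !take_oversize ?size_tuple // qn.
by rewrite (leq_ltn_trans pq qn) => /addIn.
Qed.

Hypothesis a_part : a \in partitions s n.
Hypothesis p_first : forall i, i < p -> nth 0 a p < nth 0 a i.
Hypothesis q_last : forall i, q < i -> nth 0 a i < nth 0 a q.

Let a_mono i j : i <= j -> nth 0 a j <= nth 0 a i.
Proof. by apply: geq_sorted_nth; case/andP: a_part. Qed.

Lemma move_unit_partition : move_unit a p q \in partitions s n.
Proof.
case/andP: a_part => sa /eqP ea; apply/andP; split; last by rewrite sumn_move_unit ea.
apply/(sortedP 0) => i _; rewrite /geq /= !nth_move_unit.
have := a_mono (leqnSn i); move: (@p_first i) (@q_last i.+1) pq aq.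
have [<-|] := eqVneq i.+1 p; have [<-|] := eqVneq i q; clear; lia.
Qed.

Lemma move_unit_cover : q = p.+1 \/ nth 0 a p = nth 0 a q ->
  move_unit a p q = a \/ elementary_transformation s a (move_unit a p q).
Proof.
move=> adjacent; have [E|npq] := eqVneq p q.
  by left; apply: eq_nth_tuple => i; rewrite nth_move_unit E addnK.
right; have ltpq : p < q by rewrite ltn_neqAle npq.
have S := sumn_take_move_unit.
split=> //; first exact: move_unit_partition.
- split=> [|j _]; first exact: sumn_move_unit.
  by have := S j; move: ltpq; clear; lia.
- move=> E; have := nth_move_unit p; rewrite E eqxx; move: ltpq; clear; lia.
move=> c /andP [sc _] [_ le2] [_ le1].
have c_mono i j : i <= j -> nth 0 c j <= nth 0 c i by apply: geq_sorted_nth.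
have bounds j : j <= n -> sumn (take j a) <= sumn (take j c)
    /\ sumn (take j c) + (q < j) <= sumn (take j a) + (p < j).
  by move=> jn; split; [exact: le1|rewrite -S leq_add2r; exact: le2].
have pn : p < n by apply: ltn_trans qn.
have [up|low] := ltnP (sumn (take p.+1 a)) (sumn (take p.+1 c)); [left|right].
  have E j : p < j -> j <= q -> sumn (take j c) = (sumn (take j a)).+1.
    elim: j => // j IH; rewrite ltnS leq_eqVlt => /orP [/eqP <- _|pj jq].
      by have := bounds p.+1 pn; move: up ltpq; clear; lia.
    have jq' := ltnW jq; have jn : j.+1 <= n by apply: ltn_trans qn.
    have {}IH := IH pj jq'; apply/eqP; rewrite eqn_leq; apply/andP; split.
      by have := bounds j.+1 jn; move: pj; clear; lia.
    rewrite ltnNge; apply/negP => ge.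
    case: adjacent => [qp|apq]; first by move: qp pj jq; clear; lia.
    have aj : nth 0 a j = nth 0 a q.
      by apply/eqP; rewrite eqn_leq (a_mono jq') andbT -apq a_mono // ltnW.
    have aj1 : nth 0 a j.+1 = nth 0 a q.
      by apply/eqP; rewrite eqn_leq (a_mono jq) andbT -apq a_mono // ltnW // ltnW.
    have := bounds j.+2 (leq_ltn_trans jq qn); rewrite (sumn_takeS c j.+1) (sumn_takeS a j.+1).
    have := c_mono _ _ (leqnSn j); move: ge; rewrite !sumn_takeS IH aj aj1; clear; lia.
  apply: eq_prefix_tuple => j jn; have := bounds j jn; have := S j.
  by move: (@E j); clear; lia.
have E j : p < j -> j <= q -> sumn (take j c) <= sumn (take j a).
  elim: j => // j IH; rewrite ltnS leq_eqVlt => /orP [/eqP <- //|pj jq].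
  case: adjacent => [qp|apq]; first by move: qp pj jq; clear; lia.
  rewrite !sumn_takeS; apply: leq_add; first exact: IH (ltnW jq).
  have aj : nth 0 a q <= nth 0 a j by rewrite a_mono // ltnW.
  apply: leq_trans (c_mono _ _ (ltnW pj)) _; apply: leq_trans aj; rewrite -apq.
  move: low; rewrite !sumn_takeS; have := bounds p (ltnW pn); clear; lia.
apply: eq_prefix_tuple => j jn; have := bounds j jn; move: (@E j); clear; lia.
Qed.

End MoveUnit.

Definition within l a b := exists k, k <= l /\ obtained_in s k a b.

Lemma within_refl l a : within l a a.
Proof. by exists 0. Qed.

Lemma within_cons l a c b :
  c = a \/ elementary_transformation s a c -> within l c b -> within l.+1 a b.
Proof.
move=> [->|ac] [k [kl cb]]; first by exists k; split=> //; apply: leqW.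
by exists k.+1; split=> //; exists c.
Qed.

(* The equal values ending at k are spread to M+1, M, ..., M-1, those starting at
   k+1 to m+1, m, ..., m-1, and the inner pair M-1, m+1 is then turned into M, m.
   If M = m+1 the second step would break the order, but then a single cover
   completes the move. *)
Lemma move_unit_within (e : n.-tuple nat) k p q : e \in partitions s n ->
  p <= k -> k < q -> q < n -> 0 < nth 0 e q ->
  nth 0 e p = nth 0 e k -> nth 0 e q = nth 0 e k.+1 ->
  (forall i, i < p -> nth 0 e p < nth 0 e i) ->
  (forall i, q < i -> nth 0 e i < nth 0 e q) ->
  within 3 e (move_unit e p q).
Proof.
move=> he pk kq qn eq0 ep eq p_first q_last.
have pq : p <= q by apply: leq_trans pk (ltnW kq).
have kn : k < n by apply: ltn_trans qn.
have k1n : k.+1 < n by apply: leq_ltn_trans qn.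
have mono i j : i <= j -> nth 0 e j <= nth 0 e i.
  by apply: geq_sorted_nth; case/andP: he.
have [E|nE] := eqVneq (nth 0 e k) (nth 0 e k.+1).
  by apply: within_cons (within_refl _ _); apply: move_unit_cover => //; right; rewrite ep E eq.
have lt : nth 0 e k.+1 < nth 0 e k by rewrite ltn_neqAle eq_sym nE mono.
have ek0 : 0 < nth 0 e k by apply: leq_ltn_trans lt.
have k_last i : k < i -> nth 0 e i < nth 0 e k.
  by move=> ki; apply: leq_ltn_trans lt; apply: mono.
pose c1 := move_unit e p k.
have c1E i : nth 0 c1 i = nth 0 e i + (i == p) - (i == k) by apply: nth_move_unit.
have c1P : c1 \in partitions s n by apply: move_unit_partition.
apply: (@within_cons _ _ c1); first by apply: move_unit_cover => //; right.
have low i : i <= k -> nth 0 e k <= nth 0 e i by apply: mono.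
have high i : k < i -> nth 0 e i <= nth 0 e k.+1 by apply: mono.
have [/andP [ltpk /eqP M]|far] := boolP ((p < k) && (nth 0 e k == (nth 0 e k.+1).+1)).
  have -> : move_unit e p q = move_unit c1 k q.
    apply: eq_nth_tuple => i; rewrite (nth_move_unit e pq qn) (nth_move_unit c1 (ltnW kq) qn) c1E.
    by move: ek0 ltpk kq; have [->|] := eqVneq i k; clear; lia.
  apply: within_cons (within_refl _ _); apply: move_unit_cover => //.
  - exact: ltnW.
  - by rewrite c1E; move: eq0 kq; clear; lia.
  - move=> i ik; rewrite !c1E; have := low i (ltnW ik); move: M ltpk ik; clear; lia.
  - move=> i qi; rewrite !c1E; have := q_last i qi; move: ltpk kq qi; clear; lia.
  by right; rewrite !c1E; move: M eq ltpk kq; clear; lia.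
pose c2 := move_unit c1 k.+1 q.
have c2E i : nth 0 c2 i = nth 0 c1 i + (i == k.+1) - (i == q) by apply: nth_move_unit.
have c1q : 0 < nth 0 c1 q by rewrite c1E; move: eq0 kq; clear; lia.
have c1_first i : i < k.+1 -> nth 0 c1 k.+1 < nth 0 c1 i.
  move=> ik; rewrite !c1E; have := low i ik; move: lt far pk ik.
  by have [->|] := eqVneq i k; clear; lia.
have c1_last i : q < i -> nth 0 c1 i < nth 0 c1 q.
  by move=> qi; rewrite !c1E; have := q_last i qi; move: pk kq qi; clear; lia.
have c2P : c2 \in partitions s n by apply: move_unit_partition.
apply: (@within_cons _ _ c2).
  by apply: move_unit_cover => //; right; rewrite !c1E; move: eq kq pk; clear; lia.
have -> : move_unit e p q = move_unit c2 k k.+1.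
  apply: eq_nth_tuple => i.
  rewrite (nth_move_unit e pq qn) (nth_move_unit c2 (leqnSn k) k1n) c2E c1E.
  move: ek0 pk kq eq eq0; have [->|] := eqVneq i k; first by clear; lia.
  by have [->|] := eqVneq i k.+1; clear; lia.
apply: within_cons (within_refl _ _); apply: move_unit_cover => //; last by left.
- by rewrite c2E c1E; move: eq eq0 kq pk; clear; lia.
- move=> i ik; rewrite !c2E !c1E; have := p_first i; have := low i (ltnW ik).
  move: ik ep pk kq ek0; have [->|] := eqVneq p k; clear; lia.
move=> i ki; rewrite !c2E !c1E; have := q_last i; have := high i (ltnW ki).
by move: ki pk kq eq0 eq; clear; lia.
Qed.

End Partitions.

Lemma sum_ord_lt n (F : 'I_n -> nat) k :
  \sum_(i in [set i : 'I_n | i < k]) F i = \sum_(i < n | i < k) F i.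
Proof. by apply: eq_bigl => i; rewrite inE. Qed.

Lemma sum_ord_ge n (F : 'I_n -> nat) k :
  \sum_(i in ~: [set i : 'I_n | i < k]) F i = \sum_(i < n | k <= i) F i.
Proof. by apply: eq_bigl => i; rewrite !inE -leqNgt. Qed.

Lemma split_or_decomposable_seq n (d : n.-tuple nat) (G : sgraph 'I_n) :
  realizes G d -> split_or_decomposable G -> split_seq d \/ canonically_decomposable_seq d.
Proof. by move=> dG [sG|cG]; [left|right]; exists G. Qed.

Lemma forced_nearly_tight s n (e : n.-tuple nat) (i j : 'I_n) (G : sgraph 'I_n) :
  e \in partitions s n -> realizes G e -> i < j ->
  (forall H : sgraph 'I_n, realizes H e -> H i j) \/
  (forall H : sgraph 'I_n, realizes H e -> ~~ H i j) ->
  split_or_decomposable G \/ exists2 k, 0 < k <= n & nearly_tight (tnth e) k.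
Proof.
move=> /andP [se _] dG ij.
have mono (a b : 'I_n) : a <= b -> tnth e b <= tnth e a.
  by rewrite !(tnth_nth 0); apply: geq_sorted_nth.
have n2 : 1 < n by apply: leq_ltn_trans (ltn_ord j); apply: leq_ltn_trans ij.
case=> [forced|forced].
  right; exact: (@forced_edge_tight _ _ mono G i j (Ordinal (ltnW n2)) (Ordinal n2)).
have un : n.-2 < n by move: n2; clear; lia.
have vn : n.-1 < n by move: n2; clear; lia.
have [v0|v0] := posnP (tnth e (Ordinal vn)); last first.
  right; apply: (@forced_nonedge_tight _ _ mono G i j (Ordinal un) (Ordinal vn)) => //=;
    move: n2; clear; lia.
left; apply: (@block_structure _ G [set Ordinal vn] set0).
- by rewrite setU0; apply/set0Pn; exists (Ordinal vn); rewrite inE.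
- exact: setI0.
- by move=> x y; rewrite !inE => /eqP -> /eqP ->; rewrite adj_irr.
- by move=> x y; rewrite inE.
- move=> x y _; rewrite inE => /eqP ->; rewrite adj_sym; apply/negP => Gx.
  have := dG (Ordinal vn); rewrite v0 => /eqP.
  by rewrite cards_eq0 => /eqP /setP /(_ x); rewrite !inE Gx.
by move=> x y _; rewrite inE.
Qed.

(* Here k is the 0-based index of the first vertex outside {0..k-1}. Moving
   units towards lower degrees, the gain and the loss are shifted to the first
   vertex of the degree of k-1 and the last vertex of the degree of k. *)
Lemma tighten s n (e : n.-tuple nat) k (G : sgraph 'I_n) (b y : 'I_n) :
  e \in partitions s n -> 0 < k -> nearly_tight (tnth e) k ->
  b < k -> k <= y -> k < tnth e y ->
  (forall z, deg G z + (z == y) = tnth e z + (z == b)) ->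
  exists d : n.-tuple nat, [/\ d \in partitions s n,
    split_seq d \/ canonically_decomposable_seq d & within s 3 e d].
Proof.
move=> he k0 tight bk ky dy dG.
have mono i j : i <= j -> nth 0 e j <= nth 0 e i.
  by apply: geq_sorted_nth; case/andP: he.
have kn : k < n by apply: leq_ltn_trans (ltn_ord y).
rewrite (tnth_nth 0) in dy.
have mk : k < nth 0 e k by apply: leq_trans dy (mono _ _ ky).
have exp : exists i, nth 0 e i <= nth 0 e k.-1 by exists k.-1.
case: (ex_minnP exp) => p lep minp.
have pk : p <= k.-1 by apply: minp.
have ep : nth 0 e p = nth 0 e k.-1 by apply/eqP; rewrite eqn_leq lep mono.
have p_first i : i < p -> nth 0 e p < nth 0 e i.
  by move=> ip; rewrite ep ltnNge; apply: contraTN ip => /minp; rewrite -leqNgt.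
have exq : exists i, nth 0 e k <= nth 0 e i by exists k.
have inside i : nth 0 e k <= nth 0 e i -> i < n.
  rewrite [_ < _]ltnNge; apply: contraTN => ni; rewrite -ltnNge.
  by rewrite [nth 0 e i]nth_default ?size_tuple // (leq_ltn_trans _ mk).
case: (ex_maxnP exq (fun i ki => ltnW (inside i ki))) => q geq maxq.
have kq : k <= q by apply: maxq.
have qn : q < n by apply: inside.
have eq : nth 0 e q = nth 0 e k by apply/eqP; rewrite eqn_leq geq mono.
have q_last i : q < i -> nth 0 e i < nth 0 e q.
  by move=> qi; rewrite eq ltnNge; apply: contraTN qi => /maxq; rewrite -leqNgt.
have pk' : p < k by apply: leq_ltn_trans pk _; rewrite prednK.
have pq : p < q by apply: leq_trans pk' kq.
pose P := Ordinal (ltn_trans pq qn); pose Q := Ordinal qn.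
have [G1 dG1] : exists G1 : sgraph 'I_n,
    forall z, deg G1 z + (z == y) = tnth e z + (z == P).
  have [<-|bP] := eqVneq b P; first by exists G.
  have yb := ord_ltF (leq_trans bk ky); have yP : (P == y) = false by apply/ord_ltF/(leq_trans pk').
  have [|H dH] := transfer_unit (G := G) (u := b) (v := P).
    have := dG b; have := dG P.
    rewrite eqxx (eq_sym P b) (negbTE bP) yb yP !addn0 !(tnth_nth 0) => -> ->.
    by rewrite /= ep addn1 ltnS mono // -ltnS prednK.
  exists H => z; have := dH z; have := dG z.
  by generalize (nat_of_bool (z == y)) (nat_of_bool (z == b)) (nat_of_bool (z == P)); clear; lia.
have [G2 dG2] : exists G2 : sgraph 'I_n,
    forall z, deg G2 z + (z == Q) = tnth e z + (z == P).
  have [E|yQ] := eqVneq y Q; first by exists G1; rewrite -E.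
  have yP : (y == P) = false by apply/ord_gtF/(leq_trans pk').
  have QP : (Q == P) = false by apply/ord_gtF.
  have [|H dH] := transfer_unit (G := G1) (u := Q) (v := y).
    have := dG1 y; have := dG1 Q.
    rewrite eqxx (eq_sym Q y) (negbTE yQ) yP QP !addn0 !(tnth_nth 0) => ->.
    by rewrite addn1 /= eq => /eqP; have := mono _ _ ky; clear; lia.
  exists H => z; have := dH z; have := dG1 z.
  by generalize (nat_of_bool (z == y)) (nat_of_bool (z == Q)) (nat_of_bool (z == P)); clear; lia.
have eq0 : 0 < nth 0 e q by rewrite eq; apply: leq_trans mk.
exists (move_unit e p q); split.
- by apply: move_unit_partition => //; apply: ltnW.
- apply: (split_or_decomposable_seq (G := G2)).
    move=> z; have := dG2 z; rewrite !(tnth_nth 0) (nth_move_unit e (ltnW pq) qn).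
    by rewrite -[z == P]/(z == p :> nat) -[z == Q]/(z == q :> nat) => <-; rewrite addnK.
  apply: (slack0_structure (B := [set i : 'I_n | i < k])).
    by apply/set0Pn; exists b; rewrite inE.
  rewrite (card_ord_lt (ltnW kn)) sum_ord_lt sum_ord_ge.
  have -> : \sum_(i < n | i < k) deg G2 i = (\sum_(i < n | i < k) tnth e i).+1.
    have S : \sum_(i < n | i < k) (i == P) = 1.
      by rewrite (bigD1 P) //= eqxx big1 // => i /andP [_ /negbTE ->].
    rewrite -addn1 -S -big_split /=; apply: eq_bigr => i ik.
    by have := dG2 i; rewrite (ord_ltF (j := Q)) ?addn0 //; apply: leq_trans kq.
  apply: leq_trans tight; rewrite leq_add2l; apply: leq_sum => i ki.
  have := dG2 i; rewrite (ord_gtF (j := P)) ?addn0; last exact: leq_trans ki.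
  move=> <-; rewrite leq_min geq_minl /=; apply: leq_trans (geq_minr _ _) (leq_addr _ _).
apply: (@move_unit_within s n e k.-1) => //; rewrite ?prednK //.
Qed.

Theorem theorem4p5 (s n : nat) (e : n.-tuple nat)
    (he : e \in partitions s n)
    (e_graphic : graphic e)
    (e_forced : exists i j : 'I_n, forced_pair e i j) :
  exists d : n.-tuple nat,
    [/\ d \in partitions s n,
        split_seq d \/ canonically_decomposable_seq d &
        exists k : nat, k <= 3 /\ obtained_in s k e d].
Proof.
have [G dG] := e_graphic.
have done_at_e : split_or_decomposable G -> exists d : n.-tuple nat,
    [/\ d \in partitions s n, split_seq d \/ canonically_decomposable_seq d & within s 3 e d].
  by move=> sG; exists e; split=> //; [exact: split_or_decomposable_seq sG | exact: within_refl].
have [i [j [ij forced]]] : exists i j : 'I_n, i < j /\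
    ((forall H : sgraph 'I_n, realizes H e -> H i j) \/
     (forall H : sgraph 'I_n, realizes H e -> ~~ H i j)).
  have [i [j [ij forced]]] := e_forced.
  case: (ltngtP i j) => [lt|lt|/ord_inj E]; last by rewrite E eqxx in ij.
    by exists i, j.
  exists j, i; split=> //; case: forced => F; [left|right] => H /F;
    by rewrite adj_sym.
have [/done_at_e //|[k /andP [k0 kn] tight]] := forced_nearly_tight he dG ij forced.
have B0 : [set i : 'I_n | i < k] != set0.
  by apply/set0Pn; exists (Ordinal (leq_trans k0 kn)); rewrite inE.
have := slack1_structure (G := G) B0; rewrite card_ord_lt // sum_ord_lt sum_ord_ge.
have -> : \sum_(z < n | z < k) deg G z = \sum_(z < n | z < k) tnth e z by apply: eq_bigr.
have -> : \sum_(z < n | k <= z) minn k (deg G z) = \sum_(z < n | k <= z) minn k (tnth e z).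
  by apply: eq_bigr => z _; rewrite dG.
case=> [|/done_at_e //|[b [y [H [bB yB dy dH]]]]]; first exact: tight.
rewrite !inE -?leqNgt dG in bB yB dy.
by apply: (tighten (G := H) he k0 tight bB yB dy) => z; rewrite dH dG.
Qed.
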